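(* The equation $x^4+2x^2+2x-1=0$ has exactly one root $\tilde{a}$ in $(0,1)$ ($\tilde a\approx 0.361103$). Let $f:\mathbb{D}\to\mathbb{D}$ be an analytic function with Taylor expansion $f(z)=\sum_{n=0}^\infty a_nz^n$ and suppose $|a_0|\geq\tilde{a}$. Then $$|f(z)|+\mathcal{M}_f(r)-|a_0|\leq 1$$ holds for all $z$ with $|z|=r\leq r_{|a_0|}$, where $$r_{|a_0|}:=\frac{\sqrt{(1+|a_0|)^2+|a_0|^2}-(1+|a_0|)}{|a_0|^2}.$$ This radius $r_{|a_0|}$ is sharp: for each $a\in[\tilde a,1)$, the number $r_a$ (given by the same formula with $|a_0|$ replaced by $a$) cannot be replaced by any larger number in the assertion that $|f(z)|+\mathcal{M}_f(r)-|f(0)|\leq 1$ holds for all $z$ with $|z|=r\leq r_a$ and for all analytic functions $f:\mathbb{D}\to\mathbb{D}$ with $|f(0)|=a$.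
   Context: $\mathbb{D}$ denotes the open unit disk in $\mathbb{C}$. For a complex valued analytic function $F(z)=\sum_{n=0}^\infty A_nz^n$ in $\mathbb{D}$, its majorant series is $\mathcal{M}_F(r):=\sum_{n=0}^\infty |A_n|r^n$ for $0\le r<1$. *)

(* Defs.v *)
(* Stdlib reals with Coquelicot; complex numbers are Coquelicot's C. *)
From Stdlib Require Import Reals.
From Coquelicot Require Import Coquelicot.
Open Scope R_scope.

Definition unit_disk (z : C) : Prop := Cmod z < 1.

Definition analytic_on (D : C -> Prop) (f : C -> C) : Prop :=
  forall z0 : C, D z0 ->
    exists (c : nat -> C) (rho : R), 0 < rho /\
      forall z : C, Cmod (z - z0) < rho -> is_pseries c (z - z0)%C (f z).

(* Only the values of f on the disk matter: f is a total function C -> C. *)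
Definition analytic_self_map (f : C -> C) : Prop :=
  analytic_on unit_disk f /\
  (forall z : C, unit_disk z -> unit_disk (f z)).

Definition taylor_expansion (f : C -> C) (A : nat -> C) : Prop :=
  forall z : C, unit_disk z -> is_pseries A z (f z).

(* The majorant series depends on F only through its Taylor coefficients A.
   It converges for 0 <= r < 1 whenever A is a Taylor expansion on the disk;
   outside convergence PSeries is an unspecified real. *)
Definition majorant_series (A : nat -> C) (r : R) : R :=
  PSeries (fun n => Cmod (A n)) r.

Definition bohr_radius (a : R) : R :=
  (sqrt ((1 + a) ^ 2 + a ^ 2) - (1 + a)) / a ^ 2.

(* Main.v *)
Require Import Defs.
From Stdlib Require Import Reals Lra Lia.
From Coquelicot Require Import Coquelicot.
Open Scope R_scope.

(** Write [a = |a_0|] and [r = |z|].  Two sharp estimates hold for a function [f] from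
    the disk to itself.  The Schwarz-Pick lemma gives [|f z| <= (a + r) / (1 + a r)]
    ([growth_bound]), and Bombieri's inequality gives, for [r <= a],
    [M_f(r) <= a + r (1 - a^2) / (1 - a r)] ([majorant_partial_sum_bound]).  Adding them,
    [|f z| + M_f(r) - a <= 1] follows as soon as [a^2 r^2 + 2 (1 + a) r <= 1]
    ([extremal_sum]), and the positive root of this quadratic is the radius [r_a]
    ([le_bohr_radius]).  The side condition [r_a <= a] amounts to
    [a^4 + 2 a^2 + 2 a - 1 >= 0], i.e. to [a] being at least the root of the quartic
    ([bohr_radius_le_self]).  The function [(a - z) / (1 - a z)] at [z = - r] turns both
    estimates into equalities, so the sum exceeds 1 for every [r > r_a]: this is the
    sharpness.

    Bombieri's inequality rests on the bound
    [(1 - a^2 t) * sum_(n >= 1) |a_n|^2 t^n <= t (1 - a^2)^2] for [0 <= t <= 1]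
    ([coef_square_bound]), used at [t = r / a], where [r <= a] is needed.  This bound is
    the mean over the circle [|z|^2 = t] of the Schwarz-Pick inequality
    [|f - a_0|^2 <= |z|^2 |1 - Cconj a_0 * f|^2].

    The Schwarz-Pick inequality is itself obtained by taking means, without maximum
    principle or quotients of analytic functions: where [|f| <= 1] one has
    [2 Re (f g (Cconj k)) <= |g|^2 + |k|^2], and the means of both sides over the circle,
    for suitable combinations [g] and [k] of 1 and the reproducing kernel
    [1 / (1 - Cconj z * x)], are explicit in [a_0] and [f z] ([pick_form_nonneg]).
    All of this needs only a positive linear mean, under which the nonconstant
    monomials in [x] and [Cconj x] average to 0; averaging over roots of unity
    provides it. *)

(** * Means over the unit circle *)

Lemma Cconj_RtoC (r : R) : Cconj (RtoC r) = RtoC r.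
Proof. unfold Cconj, RtoC; cbn [fst snd]. now rewrite Ropp_0. Qed.

Definition root_of_unity (n : nat) : C :=
  (cos (2 * PI / INR n), sin (2 * PI / INR n)).

(** The average is over [M + 1] points, so that it makes sense for every [M]. *)
Definition circle_avg (u : C -> C) (M : nat) : C :=
  (/ INR (S M) * sum_n (fun k => u (root_of_unity (S M) ^ k)) M)%C.

(** The mean of [u] over the unit circle with respect to arc length.  As a limit of
    averages over roots of unity it spares integration: linearity, conjugation,
    positivity and passage to uniform limits all reduce to finite sums. *)
Definition has_mean (u : C -> C) (l : C) : Prop :=
  forall eps, 0 < eps ->
    exists M0, forall M, (M0 <= M)%nat -> Cmod (circle_avg u M - l) < eps.

Lemma de_moivre (x : R) (k : nat) :
  (((cos x, sin x) : C) ^ k)%C = (cos (INR k * x), sin (INR k * x)).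
Proof.
induction k as [|k IH].
- simpl. rewrite Rmult_0_l, cos_0, sin_0. reflexivity.
- rewrite Cpow_S, IH, S_INR.
  replace ((INR k + 1) * x) with (x + INR k * x) by ring.
  rewrite cos_plus, sin_plus.
  unfold Cmult; simpl. f_equal; ring.
Qed.

Lemma Cmod_root_of_unity n : Cmod (root_of_unity n) = 1.
Proof.
unfold Cmod, root_of_unity; simpl.
replace (_ + _) with (Rsqr (sin (2 * PI / INR n)) + Rsqr (cos (2 * PI / INR n)))
  by (unfold Rsqr; ring).
rewrite sin2_cos2. apply sqrt_1.
Qed.

Lemma root_of_unity_pow_self n : (0 < n)%nat -> (root_of_unity n ^ n)%C = 1.
Proof.
intros Hn. unfold root_of_unity. rewrite de_moivre.
replace (INR n * (2 * PI / INR n)) with (2 * PI)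
  by (field; apply not_0_INR; lia).
rewrite cos_2PI, sin_2PI. reflexivity.
Qed.

Lemma root_of_unity_pow_neq_1 n m :
  (0 < m < n)%nat -> (root_of_unity n ^ m)%C <> 1.
Proof.
intros Hm H. unfold root_of_unity in H. rewrite de_moivre in H.
apply (f_equal fst) in H. simpl in H.
assert (Hn : 0 < INR n) by (apply lt_0_INR; lia).
assert (Hm0 : 0 < INR m) by (apply lt_0_INR; lia).
assert (Hmn : INR m < INR n) by (apply lt_INR; lia).
replace (INR m * (2 * PI / INR n)) with (2 * (INR m / INR n * PI)) in H by (field; lra).
rewrite cos_2a_sin in H.
assert (Hq : 0 < INR m / INR n < 1).
{ split; [apply Rdiv_lt_0_compat; lra|].
  apply (Rmult_lt_reg_r (INR n)); [lra|]. field_simplify; lra. }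
pose proof PI_RGT_0.
assert (Hs : 0 < sin (INR m / INR n * PI)) by (apply sin_gt_0; nra).
nra.
Qed.

Lemma Cmod_sum_n_le (a : nat -> C) (b : nat -> R) N :
  (forall n, (n <= N)%nat -> Cmod (a n) <= b n) ->
  Cmod (sum_n a N) <= sum_n b N.
Proof.
intros H. induction N as [|N IH].
- rewrite !sum_O. apply H; lia.
- rewrite !sum_Sn. apply Rle_trans with (1 := Cmod_triangle _ _).
  apply Rplus_le_compat; [apply IH; intros; apply H|apply H]; lia.
Qed.

Lemma INR_C_neq_0 M : RtoC (INR (S M)) <> 0.
Proof.
intros H. apply RtoC_inj in H. revert H. apply not_0_INR; lia.
Qed.

Lemma circle_avg_bound (u : C -> C) (B : R) M :
  (forall z, Cmod z = 1 -> Cmod (u z) <= B) -> Cmod (circle_avg u M) <= B.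
Proof.
intros H. unfold circle_avg. rewrite Cmod_mult, Cmod_inv by apply INR_C_neq_0.
assert (HM : 0 < INR (S M)) by (apply lt_0_INR; lia).
rewrite Cmod_R, Rabs_pos_eq by lra.
apply (Rmult_le_reg_l (INR (S M))); [lra|].
rewrite <- Rmult_assoc, Rinv_r, Rmult_1_l by lra.
rewrite <- (sum_n_const M B).
apply Cmod_sum_n_le. intros n _. apply H.
rewrite Cmod_pow, Cmod_root_of_unity. apply pow1.
Qed.

Lemma circle_avg_ext u v M :
  (forall z, Cmod z = 1 -> u z = v z) -> circle_avg u M = circle_avg v M.
Proof.
intros H. unfold circle_avg. f_equal. apply sum_n_ext. intros k. apply H.
rewrite Cmod_pow, Cmod_root_of_unity. apply pow1.
Qed.

Lemma circle_avg_plus u v M :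
  circle_avg (fun z => u z + v z)%C M = (circle_avg u M + circle_avg v M)%C.
Proof.
unfold circle_avg.
rewrite <- Cmult_plus_distr_l. f_equal.
apply (sum_n_plus (G := C_AbelianGroup)).
Qed.

Lemma circle_avg_scal (a : C) u M :
  circle_avg (fun z => a * u z)%C M = (a * circle_avg u M)%C.
Proof.
unfold circle_avg.
transitivity (/ INR (S M) * (a * sum_n (fun k => u (root_of_unity (S M) ^ k)) M))%C.
- f_equal. apply (sum_n_mult_l (K := C_Ring)).
- ring.
Qed.

Lemma Cconj_sum_n (a : nat -> C) M :
  Cconj (sum_n a M) = sum_n (fun k => Cconj (a k)) M.
Proof.
induction M as [|M IH]; [now rewrite !sum_O|].
rewrite !sum_Sn, <- IH. apply Cplus_conj.
Qed.

Lemma circle_avg_conj u M :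
  circle_avg (fun z => Cconj (u z)) M = Cconj (circle_avg u M).
Proof.
unfold circle_avg. rewrite Cmult_conj. f_equal.
- rewrite <- RtoC_inv by (apply not_0_INR; lia). symmetry; apply Cconj_RtoC.
- symmetry. apply Cconj_sum_n.
Qed.

Lemma circle_avg_const (a : C) M : circle_avg (fun _ => a) M = a.
Proof.
unfold circle_avg.
replace (sum_n (fun _ => a) M) with (INR (S M) * a)%C.
- field. apply INR_C_neq_0.
- induction M as [|M IH]; [rewrite sum_O; simpl; ring|].
  rewrite sum_Sn, <- IH. rewrite (S_INR (S M)), RtoC_plus.
  change (@plus (AbelianGroup.AbelianMonoid C_AbelianGroup)) with Cplus.
  change plus with Cplus. ring.
Qed.

Lemma Re_sum_n_nonneg (a : nat -> C) M :
  (forall k, 0 <= Re (a k)) -> 0 <= Re (sum_n a M).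
Proof.
intros Ha. induction M as [|M IH]; [rewrite sum_O; apply Ha|].
rewrite sum_Sn. change (0 <= Re (sum_n a M + a (S M))%C). rewrite re_plus.
specialize (Ha (S M)). lra.
Qed.

Lemma circle_avg_Re_nonneg u M :
  (forall z, Cmod z = 1 -> 0 <= Re (u z)) -> 0 <= Re (circle_avg u M).
Proof.
intros H. unfold circle_avg.
assert (HM : 0 < INR (S M)) by (apply lt_0_INR; lia).
rewrite <- RtoC_inv by lra. rewrite re_scal_l.
apply Rmult_le_pos; [apply Rlt_le, Rinv_0_lt_compat, HM|].
apply Re_sum_n_nonneg. intros k. apply H.
rewrite Cmod_pow, Cmod_root_of_unity. apply pow1.
Qed.

Lemma sum_n_geom (q : C) M :
  ((q - 1) * sum_n (fun k => q ^ k) M)%C = (q ^ S M - 1)%C.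
Proof.
induction M as [|M IH].
- rewrite sum_O. simpl. ring.
- rewrite sum_Sn. change plus with Cplus.
  rewrite Cmult_plus_distr_l, IH, !Cpow_S. ring.
Qed.

(** A geometric sum of ratio [w ^ n], where [w ^ n] differs from 1 but its
    [S M]-th power is 1. *)
Lemma circle_avg_pow n M :
  (0 < n <= M)%nat -> circle_avg (fun z => z ^ n)%C M = 0.
Proof.
intros Hn. unfold circle_avg.
set (w := root_of_unity (S M)).
rewrite (sum_n_ext _ (fun k => (w ^ n) ^ k)%C).
2:{ intros k. rewrite <- !Cpow_mult_r. f_equal. lia. }
assert (H : (w ^ n - 1)%C <> 0).
{ intros H. apply (root_of_unity_pow_neq_1 (S M) n); [lia|].
  fold w. replace (w ^ n)%C with ((w ^ n - 1) + 1)%C by ring. rewrite H. ring. }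
replace (sum_n (fun k => ((w ^ n) ^ k)%C) M) with (0 : C); [ring|].
transitivity (/ (w ^ n - 1) * ((w ^ n - 1) * sum_n (fun k => ((w ^ n) ^ k)) M))%C.
- rewrite sum_n_geom, <- Cpow_mult_r, (Nat.mul_comm n), Cpow_mult_r.
  unfold w at 2. rewrite root_of_unity_pow_self by lia. rewrite Cpow_1_l. ring.
- field. exact H.
Qed.

Lemma has_mean_ext u v l :
  (forall z, Cmod z = 1 -> u z = v z) -> has_mean u l -> has_mean v l.
Proof.
intros H Hu eps Heps. destruct (Hu eps Heps) as [M0 HM]. exists M0. intros M HMM.
rewrite <- (circle_avg_ext u) by exact H. auto.
Qed.

Lemma has_mean_plus u v l m :
  has_mean u l -> has_mean v m -> has_mean (fun z => u z + v z)%C (l + m).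
Proof.
intros Hu Hv eps Heps.
destruct (Hu (eps / 2)) as [M1 H1]; [lra|].
destruct (Hv (eps / 2)) as [M2 H2]; [lra|].
exists (M1 + M2)%nat. intros M HM. rewrite circle_avg_plus.
replace (_ - _)%C with ((circle_avg u M - l) + (circle_avg v M - m))%C by ring.
apply Rle_lt_trans with (1 := Cmod_triangle _ _).
specialize (H1 M ltac:(lia)). specialize (H2 M ltac:(lia)). lra.
Qed.

Lemma has_mean_scal (a : C) u l :
  has_mean u l -> has_mean (fun z => a * u z)%C (a * l).
Proof.
intros Hu eps Heps. pose proof (Cmod_ge_0 a) as Ha.
destruct (Hu (eps / (Cmod a + 1))) as [M1 H1]; [apply Rdiv_lt_0_compat; lra|].
exists M1. intros M HM. rewrite circle_avg_scal.
replace (_ - _)%C with (a * (circle_avg u M - l))%C by ring.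
rewrite Cmod_mult. specialize (H1 M HM).
pose proof (Cmod_ge_0 (circle_avg u M - l)).
apply Rle_lt_trans with ((Cmod a) * (eps / (Cmod a + 1))); [nra|].
apply (Rmult_lt_reg_r (Cmod a + 1)); [lra|]. field_simplify; nra.
Qed.

Lemma has_mean_const (a : C) : has_mean (fun _ => a) a.
Proof.
intros eps Heps. exists 0%nat. intros M _. rewrite circle_avg_const.
replace (a - a)%C with (0 : C) by ring. rewrite Cmod_0. exact Heps.
Qed.

Lemma has_mean_conj u l : has_mean u l -> has_mean (fun z => Cconj (u z)) (Cconj l).
Proof.
intros Hu eps Heps. destruct (Hu eps Heps) as [M0 HM]. exists M0. intros M HMM.
rewrite circle_avg_conj, <- Cminus_conj, Cmod_conj. auto.
Qed.

Lemma has_mean_Re_nonneg u l :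
  (forall z, Cmod z = 1 -> 0 <= Re (u z)) -> has_mean u l -> 0 <= Re l.
Proof.
intros H Hu. apply Rnot_lt_le. intros Hl.
destruct (Hu (- Re l)) as [M HM]; [lra|].
specialize (HM M (Nat.le_refl _)).
pose proof (re_le_Cmod (circle_avg u M - l)) as Hre.
unfold Cminus in Hre. rewrite re_plus, re_opp in Hre.
pose proof (circle_avg_Re_nonneg u M H).
pose proof (Rle_abs (Re (circle_avg u M) + - Re l)). unfold Cminus in HM. lra.
Qed.

(** Averages are bounded by the supremum on the circle, so a mean may be computed
    on uniform approximations. *)
Lemma has_mean_uniform_limit u l :
  (forall eps, 0 < eps -> exists v m,
     has_mean v m /\ Cmod (m - l) <= eps /\
     forall z, Cmod z = 1 -> Cmod (u z - v z) <= eps) ->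
  has_mean u l.
Proof.
intros H eps Heps.
destruct (H (eps / 3)) as (v & m & Hv & Hml & Huv); [lra|].
destruct (Hv (eps / 3)) as [M0 HM]; [lra|].
exists M0. intros M HMM. specialize (HM M HMM).
assert (Hd : Cmod (circle_avg (fun z => u z - v z)%C M) <= eps / 3)
  by (apply circle_avg_bound; exact Huv).
assert (He : circle_avg u M = (circle_avg (fun z => u z - v z) M + circle_avg v M)%C).
{ rewrite <- circle_avg_plus. apply circle_avg_ext. intros; ring. }
rewrite He.
match goal with |- Cmod ?x < _ =>
  replace x with (circle_avg (fun z => (u z - v z)%C) M
    + ((circle_avg v M - m) + (m - l)))%C by ring end.
apply Rle_lt_trans with (1 := Cmod_triangle _ _).
pose proof (Cmod_triangle (circle_avg v M - m) (m - l)). lra.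
Qed.

Lemma has_mean_pow n : (0 < n)%nat -> has_mean (fun z => z ^ n)%C 0.
Proof.
intros Hn eps Heps. exists n. intros M HM. rewrite circle_avg_pow by lia.
replace (0 - 0)%C with (0 : C) by ring. rewrite Cmod_0. exact Heps.
Qed.

(** * Means of products with power series *)

Definition partial_sum (c : nat -> C) (N : nat) (z : C) : C :=
  sum_n (fun k => c k * z ^ k)%C N.

Lemma partial_sum_S c N z :
  partial_sum c (S N) z = (partial_sum c N z + c (S N) * z ^ S N)%C.
Proof. unfold partial_sum. rewrite sum_Sn. reflexivity. Qed.

Lemma partial_sum_O c z : partial_sum c 0 z = c 0%nat.
Proof. unfold partial_sum. rewrite sum_O. simpl. ring. Qed.

Lemma pow_n_Cpow (z : C) n : pow_n z n = (z ^ n)%C.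
Proof. induction n as [|n IH]; [reflexivity|]. simpl. rewrite IH. reflexivity. Qed.

Lemma is_pseries_partial_sum (c : nat -> C) (z l : C) :
  is_pseries c z l <->
  forall eps, 0 < eps ->
    exists N0, forall N, (N0 <= N)%nat -> Cmod (partial_sum c N z - l) < eps.
Proof.
assert (E : forall N, sum_n (fun k => scal (pow_n z k) (c k)) N = partial_sum c N z).
{ intros N. apply sum_n_ext. intros k. rewrite pow_n_Cpow. apply Cmult_comm. }
unfold is_pseries, is_series. split.
- intros H eps Heps.
  assert (Hl : locally l (fun y : C => Cmod (y - l) < eps)).
  { apply (locally_le_locally_norm (V := C_NormedModule)).
    exists (mkposreal eps Heps). intros y Hy. exact Hy. }
  destruct (H _ Hl) as [N0 HN]. exists N0. intros N HNN.
  rewrite <- E. apply HN, HNN.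
- intros H P HP.
  apply (locally_norm_le_locally (V := C_NormedModule)) in HP.
  destruct HP as [eps Heps]. destruct (H eps (cond_pos eps)) as [N0 HN].
  exists N0. intros N HNN. apply Heps.
  rewrite E. apply HN, HNN.
Qed.

(** Uniform convergence on the closed disk is what lets means be computed
    coefficientwise.  Dilations of functions given by a Taylor series on the open
    disk have it. *)
Definition uniform_taylor (c : nat -> C) (u : C -> C) : Prop :=
  forall eps, 0 < eps ->
    exists N0, forall N, (N0 <= N)%nat ->
      forall z, Cmod z <= 1 -> Cmod (u z - partial_sum c N z) <= eps.

(** Convergence at a radius [s] between [Cmod w] and 1 bounds the terms there, so
    at [w * z] the series is dominated by a geometric one of ratio [Cmod w / s]. *)
Lemma taylor_dilation (A : nat -> C) (F : C -> C) (w : C) :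
  taylor_expansion F A -> Cmod w < 1 ->
  uniform_taylor (fun n => A n * w ^ n)%C (fun z => F (w * z)%C).
Proof.
intros HA Hw. pose proof (Cmod_ge_0 w) as Hw0.
set (s := (1 + Cmod w) / 2). assert (Hs : Cmod w < s < 1) by (unfold s; lra).
set (q := Cmod w / s).
assert (Hqs : q * s = Cmod w) by (unfold q; field; lra).
assert (Hq : 0 <= q < 1) by nra.
(* the terms at the larger radius [s] are eventually bounded *)
assert (HB : exists N1, forall n, (N1 <= n)%nat -> Cmod (A (S n)) * s ^ S n <= 2).
{ assert (Hd : unit_disk s).
  { unfold unit_disk. rewrite Cmod_R, Rabs_pos_eq; lra. }
  destruct (proj1 (is_pseries_partial_sum _ _ _) (HA s Hd) 1 Rlt_0_1) as [N1 H1].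
  exists N1. intros n Hn.
  pose proof (H1 n Hn) as Ha. pose proof (H1 (S n) ltac:(lia)) as Hb.
  rewrite partial_sum_S in Hb.
  assert (Hc : Cmod (A (S n) * s ^ S n) = Cmod (A (S n)) * s ^ S n).
  { rewrite Cmod_mult, Cmod_pow, Cmod_R, Rabs_pos_eq; lra. }
  rewrite <- Hc.
  replace (A (S n) * s ^ S n)%C with
    ((partial_sum A n s + A (S n) * s ^ S n - F s) + - (partial_sum A n s - F s))%C by ring.
  apply Rle_trans with (1 := Cmod_triangle _ _). rewrite Cmod_opp. lra. }
destruct HB as [N1 HB].
set (c := fun n => (A n * w ^ n)%C).
assert (Hterm : forall n, (N1 <= n)%nat -> Cmod (c (S n)) <= 2 * q ^ S n).
{ intros n Hn. unfold c. rewrite Cmod_mult, Cmod_pow, <- Hqs, Rpow_mult_distr.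
  specialize (HB n Hn). pose proof (pow_le q (S n) (proj1 Hq)). nra. }
assert (Htail : forall z N d, Cmod z <= 1 -> (N1 <= N)%nat ->
  Cmod (partial_sum c (N + d) z - partial_sum c N z)
    <= 2 * q ^ S N / (1 - q) * (1 - q ^ d)).
{ intros z N d Hz HN. induction d as [|d IH].
  - rewrite Nat.add_0_r. replace (_ - _)%C with (0 : C) by ring.
    rewrite Cmod_0. simpl. lra.
  - rewrite Nat.add_succ_r, partial_sum_S.
    replace (_ - _)%C with
      ((partial_sum c (N + d) z - partial_sum c N z) + c (S (N + d)) * z ^ S (N + d))%C by ring.
    apply Rle_trans with (1 := Cmod_triangle _ _).
    rewrite Cmod_mult, Cmod_pow.
    specialize (Hterm (N + d)%nat ltac:(lia)).
    pose proof (Cmod_ge_0 (c (S (N + d)))).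
    assert (Hp : 0 <= Cmod z ^ S (N + d) <= 1).
    { split; [apply pow_le, Cmod_ge_0|].
      rewrite <- (pow1 (S (N + d))). apply pow_incr. split; [apply Cmod_ge_0|exact Hz]. }
    assert (Ht : Cmod (c (S (N + d))) * Cmod z ^ S (N + d) <= 2 * (q ^ S N * q ^ d)).
    { rewrite <- pow_add. change (S N + d)%nat with (S (N + d)). nra. }
    replace (2 * q ^ S N / (1 - q) * (1 - q ^ S d)) with
      (2 * q ^ S N / (1 - q) * (1 - q ^ d) + 2 * (q ^ S N * q ^ d))
      by (simpl; field; lra).
    lra. }
intros eps Heps.
destruct (pow_lt_1_zero q ltac:(rewrite Rabs_pos_eq; lra) (eps * (1 - q) / 4)) as [N2 HN2].
{ apply Rdiv_lt_0_compat; nra. }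
exists (N1 + N2)%nat. intros N HN z Hz.
assert (Hwz : unit_disk (w * z)).
{ unfold unit_disk. rewrite Cmod_mult. pose proof (Cmod_ge_0 z). nra. }
destruct (proj1 (is_pseries_partial_sum _ _ _) (HA _ Hwz) (eps / 2) ltac:(lra)) as [N3 H3].
specialize (H3 (N + N3)%nat ltac:(lia)).
assert (E : partial_sum A (N + N3) (w * z) = partial_sum c (N + N3) z).
{ apply sum_n_ext. intros k. unfold c. rewrite Cpow_mult_l. apply Cmult_assoc. }
rewrite E in H3.
specialize (Htail z N N3 Hz ltac:(lia)).
specialize (HN2 (S N) ltac:(lia)). rewrite Rabs_pos_eq in HN2 by (apply pow_le; lra).
assert (Hq3 : 0 <= q ^ N3) by (apply pow_le; lra).
pose proof (pow_le q (S N) (proj1 Hq)) as HqN.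
assert (Hfin : 2 * q ^ S N / (1 - q) * (1 - q ^ N3) <= eps / 2).
{ apply Rle_trans with (2 * q ^ S N / (1 - q)).
  - assert (0 <= 2 * q ^ S N / (1 - q)) by (apply Rdiv_le_0_compat; lra). nra.
  - apply (Rmult_le_reg_r (1 - q)); [lra|]. unfold Rdiv at 1.
    rewrite Rmult_assoc, Rinv_l; lra. }
replace (_ - _)%C with
  (- (partial_sum c (N + N3) z - F (w * z))
   + (partial_sum c (N + N3) z - partial_sum c N z))%C by ring.
apply Rle_trans with (1 := Cmod_triangle _ _). rewrite Cmod_opp. lra.
Qed.

Lemma uniform_taylor_at c u z eps :
  uniform_taylor c u -> Cmod z <= 1 -> 0 < eps ->
  exists N0, forall N, (N0 <= N)%nat -> Cmod (partial_sum c N z - u z) <= eps.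
Proof.
intros H Hz Heps. destruct (H eps Heps) as [N0 HN]. exists N0. intros N HNN.
replace (_ - _)%C with (- (u z - partial_sum c N z))%C by ring.
rewrite Cmod_opp. auto.
Qed.

Lemma Cconj_unit z : Cmod z = 1 -> (z * Cconj z)%C = 1.
Proof. intros H. rewrite <- Cmod2_conj, H. f_equal. ring. Qed.

Lemma has_mean_trig i j :
  has_mean (fun z => z ^ i * Cconj (z ^ j))%C (if Nat.eqb i j then 1 else 0).
Proof.
assert (Hd : forall k d z, Cmod z = 1 -> (z ^ (k + d) * Cconj (z ^ k))%C = (z ^ d)%C).
{ intros k d z Hz. rewrite Cpow_add_r.
  transitivity (z ^ d * (z ^ k * Cconj (z ^ k)))%C; [ring|].
  rewrite Cconj_unit; [ring|]. rewrite Cmod_pow, Hz. apply pow1. }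
destruct (Nat.eqb_spec i j) as [<-|Hij].
- apply has_mean_ext with (fun _ => RtoC 1); [|apply has_mean_const].
  intros z Hz. rewrite Cconj_unit; [reflexivity|]. rewrite Cmod_pow, Hz. apply pow1.
- destruct (Nat.lt_ge_cases i j) as [H|H].
  + replace (RtoC 0) with (Cconj 0) by apply Cconj_RtoC.
    apply has_mean_ext with (fun z => Cconj (z ^ (j - i))%C).
    2:{ apply has_mean_conj, has_mean_pow. lia. }
    intros z Hz. rewrite <- (Hd i (j - i)%nat z Hz).
    replace (i + (j - i))%nat with j by lia.
    rewrite Cmult_conj, Cconj_conj. ring.
  + apply has_mean_ext with (fun z => z ^ (i - j))%C.
    2:{ apply has_mean_pow. lia. }
    intros z Hz. rewrite <- (Hd j (i - j)%nat z Hz).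
    replace (j + (i - j))%nat with i by lia. reflexivity.
Qed.

(** Uniform convergence survives multiplication by a bounded factor: the mean of
    [g * v] is the limit of the means of [g * vN N]. *)
Lemma has_mean_mul_uniform (g v : C -> C) (l : C) (B : R) (vN : nat -> C -> C) (lN : nat -> C) :
  (forall z, Cmod z = 1 -> Cmod (g z) <= B) ->
  (forall eps, 0 < eps -> exists N0, forall N, (N0 <= N)%nat ->
     forall z, Cmod z = 1 -> Cmod (v z - vN N z) <= eps) ->
  (forall eps, 0 < eps -> exists N0, forall N, (N0 <= N)%nat ->
     Cmod (lN N - l) <= eps) ->
  (forall N, has_mean (fun z => g z * vN N z)%C (lN N)) ->
  has_mean (fun z => g z * v z)%C l.
Proof.
intros Hg Hv Hl Hm. apply has_mean_uniform_limit. intros eps Heps.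
assert (HB : 0 <= B).
{ apply Rle_trans with (2 := Hg 1%C Cmod_1). apply Cmod_ge_0. }
destruct (Hv (eps / (B + 1))) as [N1 H1]; [apply Rdiv_lt_0_compat; lra|].
destruct (Hl eps Heps) as [N2 H2].
exists (fun z => g z * vN (N1 + N2)%nat z)%C, (lN (N1 + N2)%nat).
split; [apply Hm|]. split; [apply H2; lia|].
intros z Hz. specialize (H1 (N1 + N2)%nat ltac:(lia) z Hz). specialize (Hg z Hz).
replace (_ - _)%C with (g z * (v z - vN (N1 + N2)%nat z))%C by ring.
rewrite Cmod_mult. pose proof (Cmod_ge_0 (g z)). pose proof (Cmod_ge_0 (v z - vN (N1 + N2)%nat z)).
apply Rle_trans with (B * (eps / (B + 1))).
- apply Rmult_le_compat; lra.
- apply (Rmult_le_reg_r (B + 1)); [lra|]. field_simplify; nra.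
Qed.

Lemma uniform_taylor_circle c u : uniform_taylor c u ->
  forall eps, 0 < eps -> exists N0, forall N, (N0 <= N)%nat ->
     forall z, Cmod z = 1 -> Cmod (u z - partial_sum c N z) <= eps.
Proof.
intros H eps Heps. destruct (H eps Heps) as [N0 HN]. exists N0.
intros N HNN z Hz. apply HN; [exact HNN|lra].
Qed.

Lemma has_mean_conj_coef c u j :
  uniform_taylor c u -> has_mean (fun z => u z * Cconj (z ^ j))%C (c j).
Proof.
intros Hu.
apply has_mean_ext with (fun z => Cconj (z ^ j) * u z)%C; [intros; ring|].
apply has_mean_mul_uniform with 1 (partial_sum c)
  (fun N => if Nat.leb j N then c j else 0%C).
- intros z Hz. rewrite Cmod_conj, Cmod_pow, Hz, pow1. apply Rle_refl.
- apply uniform_taylor_circle, Hu.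
- intros eps Heps. exists j. intros N HN. rewrite (proj2 (Nat.leb_le j N) HN).
  replace (_ - _)%C with (0 : C) by ring. rewrite Cmod_0. lra.
- intros N. induction N as [|N IH].
  + apply has_mean_ext with (fun z => c 0%nat * (z ^ 0 * Cconj (z ^ j)))%C.
    { intros z _. rewrite partial_sum_O. simpl. ring. }
    replace (if Nat.leb j 0 then c j else RtoC 0) with
      (c 0%nat * (if Nat.eqb 0 j then 1 else 0))%C by (destruct j; simpl; ring).
    apply has_mean_scal, has_mean_trig.
  + apply has_mean_ext with
      (fun z => Cconj (z ^ j) * partial_sum c N z
                + c (S N) * (z ^ S N * Cconj (z ^ j)))%C.
    { intros z _. rewrite partial_sum_S. ring. }
    replace (if Nat.leb j (S N) then c j else RtoC 0) with
      ((if Nat.leb j N then c j else 0)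
        + c (S N) * (if Nat.eqb (S N) j then 1 else 0))%C.
    * apply has_mean_plus; [exact IH|apply has_mean_scal, has_mean_trig].
    * destruct (Nat.leb_spec j N), (Nat.leb_spec j (S N)), (Nat.eqb_spec (S N) j);
        subst; try lia; try ring.
Qed.

Lemma has_mean_pow_coef c u j :
  uniform_taylor c u ->
  has_mean (fun z => u z * z ^ j)%C (if Nat.eqb j 0 then c 0%nat else 0).
Proof.
intros Hu. destruct j as [|j].
- apply has_mean_ext with (fun z => u z * Cconj (z ^ 0))%C.
  + intros z _. simpl. now rewrite Cconj_RtoC.
  + apply has_mean_conj_coef, Hu.
- cbn [Nat.eqb]. apply has_mean_ext with (fun z => z ^ S j * u z)%C; [intros; ring|].
  apply has_mean_mul_uniform with 1 (partial_sum c) (fun _ => 0%C).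
  + intros z Hz. rewrite Cmod_pow, Hz, pow1. apply Rle_refl.
  + apply uniform_taylor_circle, Hu.
  + intros eps Heps. exists 0%nat. intros N _.
    replace (_ - _)%C with (0 : C) by ring. rewrite Cmod_0. lra.
  + intros N. induction N as [|N IH].
    * apply has_mean_ext with (fun z => c 0%nat * z ^ S j)%C.
      { intros z _. rewrite partial_sum_O. ring. }
      replace (RtoC 0) with (c 0%nat * 0)%C by ring.
      apply has_mean_scal, has_mean_pow. lia.
    * apply has_mean_ext with
        (fun z => z ^ S j * partial_sum c N z + c (S N) * z ^ (S N + S j))%C.
      { intros z _. rewrite partial_sum_S, Cpow_add_r. ring. }
      replace (RtoC 0) with (0 + c (S N) * 0)%C by ring.
      apply has_mean_plus; [exact IH|apply has_mean_scal, has_mean_pow; lia].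
Qed.

Lemma has_mean_mul_conj_partial_sum c u d N :
  uniform_taylor c u ->
  has_mean (fun z => u z * Cconj (partial_sum d N z))%C
           (sum_n (fun n => c n * Cconj (d n))%C N).
Proof.
intros Hu. induction N as [|N IH].
- rewrite sum_O. apply has_mean_ext with (fun z => Cconj (d 0%nat) * (u z * Cconj (z ^ 0)))%C.
  + intros z _. rewrite partial_sum_O. simpl.
    rewrite Cconj_RtoC. ring.
  + rewrite Cmult_comm. apply has_mean_scal, has_mean_conj_coef, Hu.
- rewrite sum_Sn. apply has_mean_ext with
    (fun z => u z * Cconj (partial_sum d N z)
              + Cconj (d (S N)) * (u z * Cconj (z ^ S N)))%C.
  + intros z _. rewrite partial_sum_S, Cplus_conj, Cmult_conj. ring.
  + rewrite (Cmult_comm (c (S N))).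
    apply has_mean_plus; [exact IH|apply has_mean_scal, has_mean_conj_coef, Hu].
Qed.

Lemma has_mean_mul_partial_sum c u d N :
  uniform_taylor c u ->
  has_mean (fun z => u z * partial_sum d N z)%C (c 0%nat * d 0%nat)%C.
Proof.
intros Hu. induction N as [|N IH].
- apply has_mean_ext with (fun z => d 0%nat * (u z * z ^ 0))%C.
  + intros z _. rewrite partial_sum_O. simpl. ring.
  + rewrite Cmult_comm. apply has_mean_scal, (has_mean_pow_coef c u 0), Hu.
- apply has_mean_ext with
    (fun z => u z * partial_sum d N z + d (S N) * (u z * z ^ S N))%C.
  + intros z _. rewrite partial_sum_S. ring.
  + replace (c 0%nat * d 0%nat)%C with (c 0%nat * d 0%nat + d (S N) * 0)%C by ring.
    apply has_mean_plus; [exact IH|].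
    apply has_mean_scal, (has_mean_pow_coef c u (S N)), Hu.
Qed.

(** A product of two power series has only nonnegative frequencies, so only its
    constant term survives. *)
Lemma has_mean_mul c u d v B :
  uniform_taylor c u -> uniform_taylor d v ->
  (forall z, Cmod z = 1 -> Cmod (u z) <= B) ->
  has_mean (fun z => u z * v z)%C (c 0%nat * d 0%nat)%C.
Proof.
intros Hu Hv HB.
apply has_mean_mul_uniform with B (partial_sum d) (fun _ => c 0%nat * d 0%nat)%C.
- exact HB.
- apply uniform_taylor_circle, Hv.
- intros eps Heps. exists 0%nat. intros N _.
  replace (_ - _)%C with (0 : C) by ring. rewrite Cmod_0. lra.
- intros N. apply has_mean_mul_partial_sum, Hu.
Qed.

(** Parseval's formula.  The sum of the series is a hypothesis, which spares its
    convergence when, as for the reproducing kernel, it is known in closed form. *)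
Lemma has_mean_mul_conj c u d v B l :
  uniform_taylor c u -> uniform_taylor d v ->
  (forall z, Cmod z = 1 -> Cmod (u z) <= B) ->
  (forall eps, 0 < eps -> exists N0, forall N, (N0 <= N)%nat ->
     Cmod (sum_n (fun n => c n * Cconj (d n))%C N - l) <= eps) ->
  has_mean (fun z => u z * Cconj (v z))%C l.
Proof.
intros Hu Hv HB Hl.
apply has_mean_mul_uniform with B (fun N z => Cconj (partial_sum d N z))
  (fun N => sum_n (fun n => c n * Cconj (d n))%C N).
- exact HB.
- intros eps Heps. destruct (uniform_taylor_circle d v Hv eps Heps) as [N0 HN].
  exists N0. intros N HNN z Hz. rewrite <- Cminus_conj, Cmod_conj. auto.
- exact Hl.
- intros N. apply has_mean_mul_conj_partial_sum, Hu.
Qed.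

Lemma has_mean_value c u : uniform_taylor c u -> has_mean u (c 0%nat).
Proof.
intros Hu. apply has_mean_ext with (fun z => u z * z ^ 0)%C.
- intros z _. simpl. ring.
- apply (has_mean_pow_coef c u 0), Hu.
Qed.

(** * The Schwarz-Pick lemma for series converging on the closed disk *)

Lemma one_minus_neq_0 (x : C) : Cmod x < 1 -> (1 - x)%C <> 0.
Proof.
intros Hx H. assert (E : x = 1%C).
{ replace x with (1 - (1 - x))%C by ring. rewrite H. ring. }
rewrite E, Cmod_1 in Hx. lra.
Qed.

Lemma taylor_geom : taylor_expansion (fun x => / (1 - x))%C (fun _ => 1%C).
Proof.
intros x Hx. unfold unit_disk in Hx. apply is_pseries_partial_sum. intros eps Heps.
pose proof (one_minus_neq_0 x Hx) as Hn.
pose proof (proj1 (Cmod_gt_0 _) Hn) as Hp.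
pose proof (Cmod_ge_0 x).
destruct (pow_lt_1_zero (Cmod x) ltac:(rewrite Rabs_pos_eq; lra) (eps * Cmod (1 - x)))
  as [N0 HN]; [nra|].
exists N0. intros N HNN. specialize (HN (S N) ltac:(lia)).
rewrite Rabs_pos_eq in HN by (apply pow_le; lra).
assert (E : (partial_sum (fun _ => 1%C) N x - / (1 - x))%C = (- (x ^ S N / (1 - x)))%C).
{ transitivity (- (((x - 1) * sum_n (fun k => x ^ k) N + 1) / (1 - x)))%C.
  - unfold partial_sum. rewrite (sum_n_ext _ (fun k => x ^ k)%C).
    + field. exact Hn.
    + intros k. apply Cmult_1_l.
  - rewrite sum_n_geom. field. exact Hn. }
rewrite E, Cmod_opp, Cmod_div, Cmod_pow by exact Hn.
apply (Rmult_lt_reg_r (Cmod (1 - x))); [exact Hp|].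
unfold Rdiv. rewrite Rmult_assoc, Rinv_l; lra.
Qed.

(** This is the pointwise inequality whose mean is the Schwarz-Pick lemma: the
    expression dominates the square of [Cmod g - Cmod k]. *)
Lemma Re_sqr_minus_cross_nonneg (f g k : C) : Cmod f <= 1 ->
  0 <= Re (k * Cconj k + g * Cconj g - 2 * (f * g * Cconj k))%C.
Proof.
intros Hf. unfold Cminus. rewrite !re_plus, re_opp, re_scal_l, <- !Cmod2_conj, !re_RtoC.
pose proof (re_le_Cmod (f * g * Cconj k)) as H.
rewrite !Cmod_mult, Cmod_conj in H.
pose proof (Rle_abs (Re (f * g * Cconj k))).
pose proof (Cmod_ge_0 f). pose proof (Cmod_ge_0 g). pose proof (Cmod_ge_0 k).
assert (Cmod f * Cmod g * Cmod k <= Cmod g * Cmod k).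
{ rewrite Rmult_assoc. pose proof (Rmult_le_pos _ _ H2 H3). nra. }
pose proof (pow2_ge_0 (Cmod g - Cmod k)). nra.
Qed.

(** Positivity of the Pick form of [u] at the points 0 and [z].  With
    [X x = / (1 - Cconj z * x)], the reproducing kernel of the Hardy space at [z],
    put [k = e0 + e1 * X] and [g = Cconj (c 0) * e0 + Cconj (u z) * e1 * X], which is
    the image of [k] under the adjoint of multiplication by [u].  The form below is
    the mean of [|k|^2 + |g|^2 - 2 Re (u g (Cconj k))], which is nonnegative where
    [|u| <= 1].  Since [|X|^2] is a combination of [X], its conjugate and 1 on the
    circle, every term has one of the six means of 1, [X], its conjugate, and
    their products with [u]. *)
Lemma pick_form_nonneg c u z e0 e1 :
  uniform_taylor c u -> (forall x, Cmod x = 1 -> Cmod (u x) <= 1) -> Cmod z < 1 ->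
  0 <= Re (e0 * Cconj e0 * (1 - c 0%nat * Cconj (c 0%nat))
           + (e0 * Cconj e1 * (1 - Cconj (c 0%nat) * u z)
              + Cconj e0 * e1 * (1 - c 0%nat * Cconj (u z)))
           + e1 * Cconj e1 * / (1 - z * Cconj z) * (1 - u z * Cconj (u z)))%C.
Proof.
intros Hu Hu1 Hz.
assert (Hzc : Cmod (Cconj z) < 1) by (rewrite Cmod_conj; exact Hz).
pose proof (taylor_dilation _ _ _ taylor_geom Hzc) as Hk. cbv beta in Hk.
set (X := fun x : C => (/ (1 - Cconj z * x))%C) in Hk.
set (d := fun n => (1 * Cconj z ^ n)%C) in Hk.
assert (Hd0 : d 0%nat = 1%C) by (unfold d; simpl; ring).
assert (HX : has_mean X 1) by (rewrite <- Hd0; apply has_mean_value, Hk).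
assert (HY : has_mean (fun x => Cconj (X x)) 1).
{ replace (RtoC 1) with (Cconj 1) by apply Cconj_RtoC.
  apply has_mean_conj, HX. }
assert (Hu0 : has_mean u (c 0%nat)) by apply has_mean_value, Hu.
assert (HuX : has_mean (fun x => u x * X x)%C (c 0%nat)).
{ replace (c 0%nat) with (c 0%nat * d 0%nat)%C by (rewrite Hd0; ring).
  apply has_mean_mul with 1; assumption. }
assert (HuY : has_mean (fun x => u x * Cconj (X x))%C (u z)).
{ apply has_mean_mul_conj with c d 1; try assumption.
  intros eps Heps.
  destruct (uniform_taylor_at c u z eps Hu ltac:(lra) Heps) as [N0 HN].
  exists N0. intros N HNN. specialize (HN N HNN).
  unfold partial_sum in HN.
  rewrite (sum_n_ext _ (fun k => c k * z ^ k)%C); [exact HN|].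
  intros n. unfold d. rewrite Cmult_conj, Cpow_conj, Cconj_conj. f_equal.
  rewrite Cconj_RtoC.
  apply Cmult_1_l. }
set (a0 := c 0%nat) in *. set (F := u z) in *.
assert (Hpz : (1 - z * Cconj z)%C <> 0).
{ apply one_minus_neq_0. rewrite Cmod_mult, Cmod_conj. pose proof (Cmod_ge_0 z). nra. }
set (p := (/ (1 - z * Cconj z))%C).
assert (HXY : forall x, Cmod x = 1 -> (X x * Cconj (X x))%C = (p * (X x + Cconj (X x) - 1))%C).
{ intros x Hx. unfold X, p.
  assert (H1 : (1 - Cconj z * x)%C <> 0).
  { apply one_minus_neq_0. rewrite Cmod_mult, Hx. lra. }
  assert (H2 : (1 - z * Cconj x)%C <> 0).
  { apply one_minus_neq_0. rewrite Cmod_mult, Cmod_conj, Hx. lra. }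
  rewrite Cinv_conj by exact H1. rewrite Cminus_conj, Cmult_conj, Cconj_conj.
  rewrite Cconj_RtoC.
  transitivity (/ ((1 - Cconj z * x) * (1 - z * Cconj x)))%C; [field; auto|].
  transitivity (/ (1 - z * Cconj z) * ((1 - z * Cconj z * (x * Cconj x)) /
                ((1 - Cconj z * x) * (1 - z * Cconj x))))%C; [|field; auto].
  rewrite (Cconj_unit x Hx). field. auto. }
(* [g = al + be * X] *)
set (al := (Cconj a0 * e0)%C). set (be := (Cconj F * e1)%C).
set (q := (p * (e1 * Cconj e1 + be * Cconj be))%C).
set (s := (p * be * Cconj e1)%C).
(* the expansion of the integrand, with [|X|^2] replaced by [p * (X + Cconj X - 1)] *)
set (E := fun x => ((e0 * Cconj e0 + al * Cconj al - q)
  + ((e1 * Cconj e0 + be * Cconj al + q) * X x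
  + ((e0 * Cconj e1 + al * Cconj be + q) * Cconj (X x)
  + ((-2 * (al * Cconj e0 - s)) * u x
  + ((-2 * (be * Cconj e0 + s)) * (u x * X x)
  + (-2 * (al * Cconj e1 + s)) * (u x * Cconj (X x)))))))%C).
assert (HE : has_mean E ((e0 * Cconj e0 + al * Cconj al - q)
  + ((e1 * Cconj e0 + be * Cconj al + q) * 1
  + ((e0 * Cconj e1 + al * Cconj be + q) * 1
  + ((-2 * (al * Cconj e0 - s)) * a0
  + ((-2 * (be * Cconj e0 + s)) * a0
  + (-2 * (al * Cconj e1 + s)) * F)))))%C).
{ unfold E. apply has_mean_plus; [apply has_mean_const|].
  apply has_mean_plus; [apply has_mean_scal, HX|].
  apply has_mean_plus; [apply has_mean_scal, HY|].
  apply has_mean_plus; [apply has_mean_scal, Hu0|].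
  apply has_mean_plus; apply has_mean_scal; assumption. }
apply has_mean_Re_nonneg in HE.
- eapply Rle_trans; [exact HE|]. apply Req_le. f_equal.
  unfold q, s, al, be. rewrite !Cmult_conj, !Cconj_conj. fold p. ring.
- intros x Hx.
  replace (E x) with
    ((e0 + e1 * X x) * Cconj (e0 + e1 * X x)
     + (al + be * X x) * Cconj (al + be * X x)
     - 2 * (u x * (al + be * X x) * Cconj (e0 + e1 * X x)))%C.
  + apply Re_sqr_minus_cross_nonneg, Hu1, Hx.
  + rewrite !Cplus_conj, (Cmult_conj e1), (Cmult_conj be).
    transitivity (E x + (e1 * Cconj e1 + be * Cconj be - 2 * u x * be * Cconj e1)
       * (X x * Cconj (X x) - p * (X x + Cconj (X x) - 1)))%C.
    * unfold E, q, s. ring.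
    * rewrite (HXY x Hx). ring.
Qed.

(** With [W = 1 - Cconj (c 0) * u z], the vector [(- |W|^2, (1 - |c 0|^2) W)] makes
    the Pick form equal to a nonnegative multiple of the difference of the two sides. *)
Lemma schwarz_pick_uniform c u z :
  uniform_taylor c u -> (forall x, Cmod x <= 1 -> Cmod (u x) <= 1) ->
  Cmod (c 0%nat) < 1 -> Cmod z < 1 ->
  (1 - Cmod z ^ 2) * Cmod (1 - Cconj (c 0%nat) * u z) ^ 2
    <= (1 - Cmod (c 0%nat) ^ 2) * (1 - Cmod (u z) ^ 2).
Proof.
intros Hu Hu1 Hc Hz.
set (W := (1 - Cconj (c 0%nat) * u z)%C).
set (t := 1 - Cmod (c 0%nat) ^ 2). set (m := 1 - Cmod (u z) ^ 2). set (n := 1 - Cmod z ^ 2).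
assert (Hn : 0 < n) by (unfold n; pose proof (Cmod_ge_0 z); nra).
assert (Ht : 0 < t) by (unfold t; pose proof (Cmod_ge_0 (c 0%nat)); nra).
assert (Hm : 0 <= m).
{ unfold m. specialize (Hu1 z ltac:(lra)). pose proof (Cmod_ge_0 (u z)). nra. }
pose proof (pick_form_nonneg c u z (- (W * Cconj W)) (t * W) Hu
  (fun x Hx => Hu1 x (Req_le _ _ Hx)) Hz) as H.
pose proof (Cmod_ge_0 W) as HW0.
set (w := Cmod W ^ 2) in *.
assert (Ew : (W * Cconj W)%C = RtoC w) by (unfold w; rewrite Cmod2_conj; reflexivity).
assert (Et : (1 - c 0%nat * Cconj (c 0%nat))%C = RtoC t).
{ unfold t. rewrite RtoC_minus, Cmod2_conj. reflexivity. }
assert (Em : (1 - u z * Cconj (u z))%C = RtoC m).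
{ unfold m. rewrite RtoC_minus, Cmod2_conj. reflexivity. }
assert (En : (1 - z * Cconj z)%C = RtoC n).
{ unfold n. rewrite RtoC_minus, Cmod2_conj. reflexivity. }
assert (EW' : (1 - c 0%nat * Cconj (u z))%C = Cconj W).
{ unfold W. rewrite Cminus_conj, Cmult_conj, Cconj_conj.
  rewrite Cconj_RtoC. reflexivity. }
fold W in H. rewrite Et, Em, En, EW' in H.
rewrite Ew, Copp_conj, Cconj_RtoC, Cmult_conj, Cconj_RtoC in H.
rewrite <- RtoC_inv in H by lra.
replace (_ + _)%C with (RtoC (w * (t * (- w + t * / n * m)))) in H.
2:{ transitivity (w * w * t + (- w * t * (W * Cconj W) * 2) + t * t * (W * Cconj W) * / n * m)%C.
    - rewrite Ew. rewrite !RtoC_mult, !RtoC_plus, RtoC_opp, !RtoC_mult.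
      rewrite RtoC_inv by lra. ring.
    - rewrite <- RtoC_inv by lra. ring. }
rewrite re_RtoC in H.
destruct (Req_dec w 0) as [Hw|Hw]; [rewrite Hw; nra|].
assert (Hw' : 0 < w) by (unfold w in *; pose proof (pow2_ge_0 (Cmod W)); lra).
assert (H1 : 0 <= - w + t * / n * m).
{ apply Rnot_lt_le. intros Hneg.
  assert (0 < w * t) by (apply Rmult_lt_0_compat; lra). nra. }
apply (Rmult_le_reg_l (/ n)); [apply Rinv_0_lt_compat, Hn|].
rewrite <- Rmult_assoc, Rinv_l by lra. nra.
Qed.

(** * Functions from the disk to itself *)

(** The estimates are first obtained on circles of radius less than 1, or for a
    parameter [t < 1]; this carries them to the endpoint. *)
Lemma le_0_at_1 (h : R -> R) (b : R) :
  b < 1 -> continuity_pt h 1 -> (forall t, b < t < 1 -> h t <= 0) -> h 1 <= 0.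
Proof.
intros Hb Hc H. apply Rnot_lt_le. intros Hpos.
destruct (Hc (h 1) Hpos) as [d [Hd Hlim]].
set (t := 1 - Rmin (d / 2) ((1 - b) / 2)).
assert (Hm : 0 < Rmin (d / 2) ((1 - b) / 2)) by (apply Rmin_glb_lt; lra).
pose proof (Rmin_l (d / 2) ((1 - b) / 2)). pose proof (Rmin_r (d / 2) ((1 - b) / 2)).
assert (Ht : h t <= 0) by (apply H; unfold t; lra).
assert (Hd' : R_dist (h t) (h 1) < h 1).
{ apply Hlim. split.
  - split; [exact I|]. unfold t; lra.
  - simpl. unfold R_dist, t. rewrite Rabs_left1; lra. }
unfold R_dist in Hd'. apply Rabs_def2 in Hd'. lra.
Qed.

Lemma taylor_coef_0 (f : C -> C) (A : nat -> C) :
  taylor_expansion f A -> f 0%C = A 0%nat.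
Proof.
intros HA.
assert (H0 : unit_disk 0) by (unfold unit_disk; rewrite Cmod_0; lra).
pose proof (proj1 (is_pseries_partial_sum _ _ _) (HA _ H0)) as H.
assert (E : forall N, partial_sum A N 0 = A 0%nat).
{ intros N. induction N as [|N IH]; [apply partial_sum_O|].
  rewrite partial_sum_S, IH, Cpow_S. ring. }
destruct (Req_dec (Cmod (A 0%nat - f 0%C)) 0) as [Hz|Hz].
- apply Cmod_eq_0 in Hz. replace (f 0%C) with (A 0%nat - (A 0%nat - f 0%C))%C by ring.
  rewrite Hz. ring.
- pose proof (Cmod_ge_0 (A 0%nat - f 0%C)).
  destruct (H (Cmod (A 0%nat - f 0%C)) ltac:(lra)) as [N HN].
  specialize (HN N (Nat.le_refl _)). rewrite E in HN. lra.
Qed.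

Definition schur_function (f : C -> C) (A : nat -> C) : Prop :=
  (forall z, unit_disk z -> unit_disk (f z)) /\ taylor_expansion f A.

Lemma Cmod_coef_0_lt_1 f A : schur_function f A -> Cmod (A 0%nat) < 1.
Proof.
intros [Hmap HA]. rewrite <- (taylor_coef_0 f A HA). apply Hmap.
unfold unit_disk. rewrite Cmod_0. lra.
Qed.

Lemma scaled_in_disk (s : R) x : 0 < s < 1 -> Cmod x <= 1 -> unit_disk (s * x)%C.
Proof.
intros Hs Hx. unfold unit_disk. rewrite Cmod_mult, Cmod_R, Rabs_pos_eq by lra.
pose proof (Cmod_ge_0 x). nra.
Qed.

Lemma Cmod_real_lt_1 (s : R) : 0 < s < 1 -> Cmod s < 1.
Proof. intros Hs. rewrite Cmod_R, Rabs_pos_eq; lra. Qed.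

(** Apply the lemma for uniformly convergent series to [x |-> f (s * x)] at the
    point [z / s], and let [s] tend to 1. *)
Lemma schwarz_pick f A z : schur_function f A -> unit_disk z ->
  (1 - Cmod z ^ 2) * Cmod (1 - Cconj (A 0%nat) * f z) ^ 2
    <= (1 - Cmod (A 0%nat) ^ 2) * (1 - Cmod (f z) ^ 2).
Proof.
intros HS Hz. pose proof (Cmod_coef_0_lt_1 f A HS) as Ha. destruct HS as [Hmap HA].
set (X := (1 - Cmod (A 0%nat) ^ 2) * (1 - Cmod (f z) ^ 2)).
set (Y := Cmod (1 - Cconj (A 0%nat) * f z) ^ 2).
cut ((1 - (Cmod z / 1) ^ 2) * Y - X <= 0); [rewrite Rdiv_1_r; lra|].
apply (le_0_at_1 (fun s => (1 - (Cmod z / s) ^ 2) * Y - X) (Cmod z) Hz).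
- reg; lra.
- intros s Hs. pose proof (Cmod_ge_0 z).
  assert (Hs' : 0 < s < 1) by lra.
  assert (Hsn : RtoC s <> 0) by (intros E; apply RtoC_inj in E; lra).
  assert (Ezs : (s * (z / s))%C = z) by (field; exact Hsn).
  assert (Mzs : Cmod (z / s) = Cmod z / s).
  { rewrite Cmod_div by exact Hsn. rewrite Cmod_R, Rabs_pos_eq; lra. }
  assert (E0 : (A 0%nat * s ^ 0)%C = A 0%nat) by (simpl; ring).
  pose proof (schwarz_pick_uniform (fun n => A n * s ^ n)%C (fun x => f (s * x)%C) (z / s)%C
    (taylor_dilation A f s HA (Cmod_real_lt_1 s Hs'))) as H1.
  cbv beta in H1. rewrite E0, Ezs, Mzs in H1. fold X Y in H1.
  enough ((1 - (Cmod z / s) ^ 2) * Y <= X) by lra.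
  apply H1; [|exact Ha|].
  + intros x Hx. apply Rlt_le, Hmap, scaled_in_disk; assumption.
  + apply (Rmult_lt_reg_r s); [lra|]. field_simplify; lra.
Qed.

Lemma schwarz_pick_dist f A z : schur_function f A -> unit_disk z ->
  Cmod (f z - A 0%nat) ^ 2 <= Cmod z ^ 2 * Cmod (1 - Cconj (A 0%nat) * f z) ^ 2.
Proof.
intros HS Hz. pose proof (schwarz_pick f A z HS Hz) as H.
assert (E : Cmod (1 - Cconj (A 0%nat) * f z) ^ 2 - Cmod (f z - A 0%nat) ^ 2
  = (1 - Cmod (A 0%nat) ^ 2) * (1 - Cmod (f z) ^ 2)).
{ rewrite !Cmod2_alt. destruct (f z) as [x y], (A 0%nat) as [a b]. simpl. ring. }
lra.
Qed.

(** With [F = |f z|], [a = |A 0|] and [r = |z|], the bound [|1 - Cconj (A 0) * f z|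
    >= 1 - a F] turns the Schwarz-Pick inequality into [(F - a)^2 <= r^2 (1 - a F)^2]. *)
Lemma growth_bound f A z : schur_function f A -> unit_disk z ->
  Cmod (f z) * (1 + Cmod (A 0%nat) * Cmod z) <= Cmod (A 0%nat) + Cmod z.
Proof.
intros HS Hz. pose proof (schwarz_pick f A z HS Hz) as H.
pose proof (proj1 HS z Hz) as Hf. unfold unit_disk in *.
pose proof (Cmod_coef_0_lt_1 f A HS) as Ha.
pose proof (Cmod_ge_0 z). pose proof (Cmod_ge_0 (f z)). pose proof (Cmod_ge_0 (A 0%nat)).
assert (HW : 1 - Cmod (A 0%nat) * Cmod (f z) <= Cmod (1 - Cconj (A 0%nat) * f z)).
{ pose proof (Cmod_triangle (1 - Cconj (A 0%nat) * f z) (Cconj (A 0%nat) * f z)) as Ht.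
  replace (1 - Cconj (A 0%nat) * f z + Cconj (A 0%nat) * f z)%C with (RtoC 1) in Ht by ring.
  rewrite Cmod_1, Cmod_mult, Cmod_conj in Ht. lra. }
set (a := Cmod (A 0%nat)) in *. set (F := Cmod (f z)) in *. set (r := Cmod z) in *.
set (w := Cmod (1 - Cconj (A 0%nat) * f z)) in *.
assert (0 <= 1 - a * F) by nra.
assert (Hr2 : 0 < 1 - r ^ 2) by nra.
assert (H4 : (1 - r ^ 2) * (1 - a * F) ^ 2 <= (1 - a ^ 2) * (1 - F ^ 2)).
{ apply Rle_trans with (2 := H). apply Rmult_le_compat_l; [lra|]. apply pow_incr; lra. }
assert (H5 : (F - a) ^ 2 <= (r * (1 - a * F)) ^ 2) by nra.
assert (H6 : 0 <= r * (1 - a * F)) by (apply Rmult_le_pos; lra).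
assert (F - a <= r * (1 - a * F)) by nra.
lra.
Qed.

(** * Bombieri's inequality for the majorant series *)

Definition coef_square_sum (A : nat -> C) (t : R) (N : nat) : R :=
  sum_n (fun n => if Nat.eqb n 0 then 0 else Cmod (A n) ^ 2 * t ^ n) N.

Lemma partial_sum_truncate (d : nat -> C) N : (forall n, (N < n)%nat -> d n = 0%C) ->
  uniform_taylor d (partial_sum d N).
Proof.
intros Hd eps Heps. exists N. intros N' HN' z _.
replace (partial_sum d N' z) with (partial_sum d N z).
- replace (_ - _)%C with (RtoC 0) by ring. rewrite Cmod_0. lra.
- induction HN' as [|m Hm IH]; [reflexivity|].
  rewrite partial_sum_S, <- IH, Hd by lia. ring.
Qed.

(** Take means, on the circle of radius [s], in the Schwarz-Pick inequality
    [|f - A 0|^2 <= s^2 |1 - Cconj (A 0) * f|^2].  With [b = 1 - |A 0|^2] the right side is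
    [s^2 |b - Cconj (A 0) (f - A 0)|^2]; its cross term has mean 0, so the mean of
    [|f - A 0|^2] is at most [s^2 b^2 / (1 - |A 0|^2 s^2)].  Bessel's inequality for the
    truncation [Q] of [f - A 0] then bounds the finite sum. *)
Lemma coef_square_bound_sqr f A (s : R) N : schur_function f A -> 0 < s < 1 ->
  (1 - Cmod (A 0%nat) ^ 2 * s ^ 2) * coef_square_sum A (s ^ 2) N
    <= s ^ 2 * (1 - Cmod (A 0%nat) ^ 2) ^ 2.
Proof.
intros Hf Hs. pose proof (taylor_dilation A f s (proj2 Hf) (Cmod_real_lt_1 s Hs)) as Hu.
set (c := fun n => (A n * s ^ n)%C) in Hu. set (u := fun x => f (s * x)%C) in Hu.
cbv beta in Hu.
assert (Ec0 : c 0%nat = A 0%nat) by (unfold c; simpl; ring).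
set (d := fun n => if andb (Nat.ltb 0 n) (Nat.leb n N) then c n else 0%C).
assert (Hd0 : d 0%nat = 0%C) by reflexivity.
assert (Hq : uniform_taylor d (partial_sum d N)).
{ apply (partial_sum_truncate d N). intros n Hn. unfold d.
  rewrite (proj2 (Nat.leb_gt n N) Hn), Bool.andb_false_r. reflexivity. }
set (Q := partial_sum d N) in Hq.
set (D := coef_square_sum A (s ^ 2) N).
assert (HD : forall e : nat -> C, (forall n, (n <= N)%nat -> (0 < n)%nat -> e n = c n) ->
  sum_n (fun n => e n * Cconj (d n))%C N = RtoC D).
{ intros e He. unfold D, coef_square_sum.
  assert (Ht : forall n, (n <= N)%nat -> (e n * Cconj (d n))%C =
    RtoC (if Nat.eqb n 0 then 0 else Cmod (A n) ^ 2 * (s ^ 2) ^ n)).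
  { intros n Hn. destruct n as [|n].
    - rewrite Hd0, Cconj_RtoC. simpl. ring.
    - rewrite He by lia. unfold d. rewrite (proj2 (Nat.leb_le (S n) N) Hn).
      cbn [Nat.ltb Nat.leb andb Nat.eqb].
      rewrite <- Cmod2_conj. f_equal. unfold c.
      rewrite Cmod_mult, Cmod_pow, Cmod_R, Rabs_pos_eq by lra.
      rewrite Rpow_mult_distr, <- !pow_mult. f_equal. f_equal. lia. }
  rewrite (sum_n_ext_loc _ _ N Ht). clear.
  generalize (fun n => if Nat.eqb n 0 then 0 else Cmod (A n) ^ 2 * (s ^ 2) ^ n).
  intros b. induction N as [|M IH]; [now rewrite !sum_O|].
  rewrite !sum_Sn, IH. symmetry. apply RtoC_plus. }
assert (HuQ : has_mean (fun x => u x * Cconj (Q x))%C D).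
{ rewrite <- (HD c) by auto. apply has_mean_mul_conj_partial_sum, Hu. }
assert (HQQ : has_mean (fun x => Q x * Cconj (Q x))%C D).
{ rewrite <- (HD d).
  - apply has_mean_mul_conj_partial_sum, Hq.
  - intros n H1 H2. unfold d. rewrite (proj2 (Nat.leb_le n N) H1), (proj2 (Nat.ltb_lt 0 n) H2).
    reflexivity. }
assert (HQ : has_mean (fun x => Cconj (Q x)) 0).
{ rewrite <- (Cconj_RtoC 0), <- Hd0. apply has_mean_conj, has_mean_value, Hq. }
assert (Hu0 : has_mean u (A 0%nat)) by (rewrite <- Ec0; apply has_mean_value, Hu).
set (a0 := A 0%nat) in *. set (b := 1 - Cmod a0 ^ 2).
set (g := 1 - Cmod a0 ^ 2 * s ^ 2).
assert (Hb : 0 < b).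
{ unfold b, a0. pose proof (Cmod_coef_0_lt_1 f A Hf). pose proof (Cmod_ge_0 (A 0%nat)). nra. }
assert (Hg : 0 < g) by (unfold g, b in *; pose proof (pow2_ge_0 (Cmod a0)); nra).
(* This function has nonnegative real part on the circle: it is the Schwarz-Pick
   inequality with [|u - a0|^2] replaced by its lower bound
   [2 Re ((u - a0) * Cconj Q) - |Q|^2]. *)
assert (HE : has_mean (fun x => (s ^ 2 * b ^ 2 + 2 * s ^ 2 * b * Cconj a0 * a0)
  + ((-2 * s ^ 2 * b * Cconj a0) * u x
  + ((-2 * g) * (u x * Cconj (Q x))
  + ((2 * g * a0) * Cconj (Q x)
  + g * (Q x * Cconj (Q x))))))%C
  ((s ^ 2 * b ^ 2 + 2 * s ^ 2 * b * Cconj a0 * a0)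
  + ((-2 * s ^ 2 * b * Cconj a0) * a0
  + ((-2 * g) * D + ((2 * g * a0) * 0 + g * D))))%C).
{ apply has_mean_plus; [apply has_mean_const|].
  apply has_mean_plus; [apply has_mean_scal, Hu0|].
  apply has_mean_plus; [apply has_mean_scal, HuQ|].
  apply has_mean_plus; apply has_mean_scal; assumption. }
apply has_mean_Re_nonneg in HE.
- replace (_ + _)%C with (RtoC (s ^ 2 * b ^ 2 - g * D)) in HE.
  + rewrite re_RtoC in HE. fold b g. lra.
  + rewrite RtoC_minus, !RtoC_mult, !RtoC_pow. ring.
- intros x Hx.
  assert (Hsx : unit_disk (s * x)%C) by (apply scaled_in_disk; lra).
  pose proof (schwarz_pick_dist f A _ Hf Hsx) as HS. fold (u x) a0 in HS.
  rewrite Cmod_mult, Hx, Cmod_R, Rabs_pos_eq, Rmult_1_r in HS by lra.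
  assert (E : Cmod (1 - Cconj a0 * u x) ^ 2 =
     b ^ 2 - 2 * b * Re (Cconj a0 * (u x - a0))%C + Cmod a0 ^ 2 * Cmod (u x - a0) ^ 2).
  { unfold b. rewrite !Cmod2_alt. destruct (u x) as [x1 y1], a0 as [a1 b1]. simpl. ring. }
  rewrite E in HS. clear E.
  assert (E : Cmod (u x - a0 - Q x) ^ 2 = Cmod (u x - a0) ^ 2
     - 2 * Re ((u x - a0) * Cconj (Q x))%C + Re (Q x * Cconj (Q x))%C).
  { rewrite !Cmod2_alt. destruct (u x) as [x1 y1], a0 as [a1 b1], (Q x) as [x2 y2]. simpl. ring. }
  pose proof (pow2_ge_0 (Cmod (u x - a0 - Q x))) as HP. rewrite E in HP. clear E.
  match goal with |- 0 <= Re ?e =>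
    replace e with (RtoC (s ^ 2 * b ^ 2) + RtoC (- (2 * s ^ 2 * b)) * (Cconj a0 * (u x - a0))
      + RtoC (- (2 * g)) * ((u x - a0) * Cconj (Q x)) + RtoC g * (Q x * Cconj (Q x)))%C end.
  2:{ rewrite !RtoC_opp, !RtoC_mult, !RtoC_pow. ring. }
  rewrite !re_plus, !re_scal_l, re_RtoC.
  set (p1 := Re (Cconj a0 * (u x - a0))%C) in *.
  set (p2 := Re ((u x - a0) * Cconj (Q x))%C) in *.
  set (p3 := Re (Q x * Cconj (Q x))%C) in *.
  set (v := Cmod (u x - a0) ^ 2) in *.
  assert (HP' : 0 <= g * (v - 2 * p2 + p3)) by (apply Rmult_le_pos; lra).
  unfold g in *. nra.
Qed.

Lemma coef_square_bound f A t N : schur_function f A -> 0 <= t <= 1 ->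
  (1 - Cmod (A 0%nat) ^ 2 * t) * coef_square_sum A t N
    <= t * (1 - Cmod (A 0%nat) ^ 2) ^ 2.
Proof.
intros Hf. assert (Hlt : forall t, 0 < t < 1 -> (1 - Cmod (A 0%nat) ^ 2 * t) * coef_square_sum A t N
    <= t * (1 - Cmod (A 0%nat) ^ 2) ^ 2).
{ intros x Hx. pose proof (coef_square_bound_sqr f A (sqrt x) N Hf) as H.
  rewrite pow2_sqrt in H by lra. apply H. split; [apply sqrt_lt_R0; lra|].
  rewrite <- sqrt_1. apply sqrt_lt_1; lra. }
intros Ht. destruct (Req_dec t 0) as [->|Ht0].
{ assert (E : coef_square_sum A 0 N = 0).
  { unfold coef_square_sum. clear. induction N as [|M IH]; [now rewrite sum_O|].
    rewrite sum_Sn, IH. change plus with Rplus. simpl. ring. }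
  rewrite E. lra. }
destruct (Req_dec t 1) as [->|Ht1]; [|apply Hlt; lra].
enough ((1 - Cmod (A 0%nat) ^ 2 * 1) * coef_square_sum A 1 N
    - 1 * (1 - Cmod (A 0%nat) ^ 2) ^ 2 <= 0) by lra.
apply (le_0_at_1 (fun x => (1 - Cmod (A 0%nat) ^ 2 * x) * coef_square_sum A x N
    - x * (1 - Cmod (A 0%nat) ^ 2) ^ 2) 0); [lra| |].
- assert (Hc : continuity_pt (fun x => coef_square_sum A x N) 1).
  { unfold coef_square_sum. clear. induction N as [|M IH].
    - apply continuity_pt_ext with (fun _ => 0); [intros; now rewrite sum_O|]. reg.
    - apply continuity_pt_ext with
        (fun x => sum_n (fun n => if Nat.eqb n 0 then 0 else Cmod (A n) ^ 2 * x ^ n) M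
                  + Cmod (A (S M)) ^ 2 * x ^ S M).
      { intros x. rewrite sum_Sn. reflexivity. }
      apply (continuity_pt_plus (fun x => sum_n _ M)); [exact IH|]. reg. }
  apply continuity_pt_minus; [|reg].
  apply continuity_pt_mult; [reg|exact Hc].
- intros x Hx. specialize (Hlt x ltac:(lra)). lra.
Qed.

(** Write [|A n| r^n] as the product of [|A n| t^(n/2)] and [(a r)^(n/2)] with
    [t = r / a], which is at most 1 exactly when [r <= a].  The arithmetic-geometric
    mean inequality, in place of Cauchy-Schwarz, leaves the sum of squares already
    bounded and a geometric series. *)
Lemma majorant_partial_sum_bound f A r N : schur_function f A ->
  0 < Cmod (A 0%nat) -> 0 <= r <= Cmod (A 0%nat) ->
  sum_n (fun n => Cmod (A n) * r ^ n) N
    <= Cmod (A 0%nat) + r * (1 - Cmod (A 0%nat) ^ 2) / (1 - Cmod (A 0%nat) * r).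
Proof.
intros Hf Ha0 Hr. pose proof (Cmod_coef_0_lt_1 f A Hf) as Ha1.
set (a := Cmod (A 0%nat)) in *.
assert (Hb : 0 < 1 - a ^ 2) by nra.
assert (Har : 0 <= a * r < 1) by nra.
set (t := r / a).
assert (Hta : t * a = r) by (unfold t; field; lra).
assert (Ht : 0 <= t <= 1) by (split; nra).
pose proof (coef_square_bound f A t N Hf Ht) as HS. fold a in HS.
replace (1 - a ^ 2 * t) with (1 - a * r) in HS by (rewrite <- Hta; ring).
(* weighting the squares by [la] balances the two sums obtained below *)
set (la := a / (1 - a ^ 2)).
assert (Hla : 0 < la) by (apply Rdiv_lt_0_compat; lra).
assert (Hgeom : forall M, sum_n (fun n => if Nat.eqb n 0 then 0 else (a * r) ^ n) M
   = a * r * (1 - (a * r) ^ M) / (1 - a * r)).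
{ intros M. induction M as [|M IH].
  - rewrite sum_O. simpl. field. lra.
  - rewrite sum_Sn, IH. change plus with Rplus. simpl. field. lra. }
assert (Hterm : sum_n (fun n => Cmod (A n) * r ^ n) N <=
  a + (la / 2 * coef_square_sum A t N
       + / (2 * la) * sum_n (fun n => if Nat.eqb n 0 then 0 else (a * r) ^ n) N)).
{ unfold coef_square_sum. clear HS. induction N as [|M IH].
  - rewrite !sum_O. simpl. fold a. lra.
  - rewrite !sum_Sn. change plus with Rplus. cbn [Nat.eqb].
    assert (H : Cmod (A (S M)) * r ^ S M <=
       la / 2 * (Cmod (A (S M)) ^ 2 * t ^ S M) + / (2 * la) * (a * r) ^ S M).
    { set (n := S M). set (m := Cmod (A n)).
      rewrite Rpow_mult_distr, <- Hta, Rpow_mult_distr.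
      assert (0 <= t ^ n) by (apply pow_le; lra).
      pose proof (pow2_ge_0 (la * m - a ^ n)) as Hsq.
      apply (Rmult_le_reg_l (2 * la)); [lra|].
      replace (2 * la * (la / 2 * (m ^ 2 * t ^ n) + / (2 * la) * (a ^ n * (t ^ n * a ^ n))))
        with (t ^ n * (la ^ 2 * m ^ 2 + (a ^ n) ^ 2)) by (field; lra).
      nra. }
    lra. }
rewrite Hgeom in Hterm.
assert (H1 : coef_square_sum A t N <= t * (1 - a ^ 2) ^ 2 / (1 - a * r)).
{ apply (Rmult_le_reg_r (1 - a * r)); [lra|]. unfold Rdiv.
  rewrite Rmult_assoc, Rinv_l by lra. lra. }
assert (Hp : 0 <= (a * r) ^ N) by (apply pow_le; lra).
assert (H2 : a * r * (1 - (a * r) ^ N) / (1 - a * r) <= a * r / (1 - a * r)).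
{ apply Rmult_le_compat_r; [apply Rlt_le, Rinv_0_lt_compat; lra|]. nra. }
assert (Hila : 0 < / (2 * la)) by (apply Rinv_0_lt_compat; lra).
assert (Ef : la / 2 * (t * (1 - a ^ 2) ^ 2 / (1 - a * r)) + / (2 * la) * (a * r / (1 - a * r))
   = r * (1 - a ^ 2) / (1 - a * r)).
{ unfold la, t. field. lra. }
assert (la / 2 * coef_square_sum A t N <= la / 2 * (t * (1 - a ^ 2) ^ 2 / (1 - a * r)))
  by (apply Rmult_le_compat_l; lra).
assert (/ (2 * la) * (a * r * (1 - (a * r) ^ N) / (1 - a * r))
   <= / (2 * la) * (a * r / (1 - a * r)))
  by (apply Rmult_le_compat_l; lra).
lra.
Qed.

Lemma PSeries_le_of_partial_sums (b : nat -> R) (r B : R) :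
  (forall n, 0 <= b n) -> 0 <= r ->
  (forall N, sum_n (fun n => b n * r ^ n) N <= B) -> PSeries b r <= B.
Proof.
intros Hb Hr HB. unfold PSeries, Series.
apply (Rbar_le_trans (Finite _) (Lim_seq (fun _ => B)) (Finite B)).
2:{ rewrite Lim_seq_const. apply Rle_refl. }
assert (Hex : ex_finite_lim_seq (sum_n (fun n => b n * r ^ n))).
{ apply ex_finite_lim_seq_incr with B; [|exact HB].
  intros n. rewrite sum_Sn. change plus with Rplus.
  pose proof (Rmult_le_pos _ _ (Hb (S n)) (pow_le r (S n) Hr)). lra. }
apply Lim_seq_correct' in Hex.
apply is_lim_seq_le with (sum_n (fun n => b n * r ^ n)) (fun _ => B).
- exact HB.
- exact Hex.
- rewrite Lim_seq_const. apply is_lim_seq_const.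
Qed.

(** * The quartic and the radius *)

Definition quartic (x : R) : R := x ^ 4 + 2 * x ^ 2 + 2 * x - 1.

Lemma quartic_increasing x y : 0 <= x < y -> quartic x < quartic y.
Proof.
intros H. unfold quartic.
assert (x ^ 2 < y ^ 2) by nra.
assert (x ^ 4 < y ^ 4).
{ replace (x ^ 4) with ((x ^ 2) ^ 2) by ring. replace (y ^ 4) with ((y ^ 2) ^ 2) by ring.
  pose proof (pow2_ge_0 x). nra. }
lra.
Qed.

Lemma quartic_root_unique :
  exists! x : R, 0 < x < 1 /\ x ^ 4 + 2 * x ^ 2 + 2 * x - 1 = 0.
Proof.
destruct (IVT quartic 0 1) as [x [Hx Hx0]].
- unfold quartic. intros y. reg.
- lra.
- unfold quartic. lra.
- unfold quartic. lra.
- exists x. split.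
  + split; [|exact Hx0].
    split; apply Rnot_le_lt; intros H.
    * assert (x = 0) by lra. subst. unfold quartic in Hx0. lra.
    * assert (x = 1) by lra. subst. unfold quartic in Hx0. lra.
  + intros y [Hy Hy0]. fold (quartic y) in Hy0.
    destruct (Rtotal_order x y) as [H|[H|H]]; [|exact H|].
    * pose proof (quartic_increasing x y ltac:(lra)). lra.
    * pose proof (quartic_increasing y x ltac:(lra)). lra.
Qed.

Lemma quartic_root_approx ta : 0 < ta < 1 -> quartic ta = 0 ->
  Rabs (ta - 361103 / 10 ^ 6) <= 5 / 10 ^ 7.
Proof.
intros Ht H. apply Rabs_le. split; apply Rnot_lt_le; intros Hlt.
- pose proof (quartic_increasing ta (3611025 / 10 ^ 7) ltac:(lra)) as Hq.
  unfold quartic in Hq at 2. lra.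
- pose proof (quartic_increasing (3611035 / 10 ^ 7) ta ltac:(lra)) as Hq.
  unfold quartic in Hq at 1. lra.
Qed.

Lemma le_bohr_radius a r : 0 < a -> 0 <= r ->
  (r <= bohr_radius a <-> a ^ 2 * r ^ 2 + 2 * (1 + a) * r <= 1).
Proof.
intros Ha Hr. unfold bohr_radius.
set (S := sqrt ((1 + a) ^ 2 + a ^ 2)).
assert (HS : 0 <= S) by apply sqrt_pos.
assert (HS2 : S ^ 2 = (1 + a) ^ 2 + a ^ 2) by (apply pow2_sqrt; nra).
assert (Ha2 : 0 < a ^ 2) by nra.
rewrite <- Rcomplements.Rle_div_r by exact Ha2.
assert (E : a ^ 2 * (a ^ 2 * r ^ 2 + 2 * (1 + a) * r - 1) = (r * a ^ 2 + (1 + a)) ^ 2 - S ^ 2)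
  by (rewrite HS2; ring).
assert (Hra : 0 <= r * a ^ 2) by nra.
split; intros H.
- assert ((r * a ^ 2 + (1 + a)) ^ 2 <= S ^ 2) by (apply pow_incr; lra).
  nra.
- assert ((r * a ^ 2 + (1 + a)) ^ 2 <= S ^ 2) by nra.
  enough (r * a ^ 2 + (1 + a) <= S) by lra. nra.
Qed.

Lemma bohr_radius_pos a : 0 < a -> 0 < bohr_radius a.
Proof.
intros Ha. apply Rlt_le_trans with (/ (a ^ 2 + 2 * (1 + a))).
- apply Rinv_0_lt_compat. nra.
- set (d := a ^ 2 + 2 * (1 + a)). assert (Hd : 1 < d) by (unfold d; nra).
  assert (Hi : 0 < / d) by (apply Rinv_0_lt_compat; lra).
  assert (Hi1 : / d * d = 1) by (apply Rinv_l; lra).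
  apply le_bohr_radius; [exact Ha|lra|].
  unfold d in *. nra.
Qed.

(** By the quadratic characterization, [a] itself is at least the radius exactly
    when [a^4 + 2 a (1 + a) >= 1], which is where the quartic comes from. *)
Lemma bohr_radius_le_self a : 0 < a -> 0 <= quartic a -> bohr_radius a <= a.
Proof.
intros Ha Hq. apply Rnot_lt_le. intros H.
pose proof (proj1 (le_bohr_radius a (bohr_radius a) Ha ltac:(lra)) (Rle_refl _)) as H1.
unfold quartic in Hq. set (r := bohr_radius a) in *.
assert (a ^ 2 * a ^ 2 < a ^ 2 * r ^ 2) by (apply Rmult_lt_compat_l; nra).
assert (2 * (1 + a) * a < 2 * (1 + a) * r) by nra.
nra.
Qed.

(** The left side is the excess over 1 reached by the extremal function, and an
    upper bound, when [r <= a], for the excess of any other; its sign is that of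
    the quadratic defining the radius. *)
Lemma extremal_sum a r : 0 < a < 1 -> 0 <= r < 1 ->
  (a + r) / (1 + a * r) + r * (1 - a ^ 2) / (1 - a * r) - 1
  = (1 - a) * (a ^ 2 * r ^ 2 + 2 * (1 + a) * r - 1) / ((1 + a * r) * (1 - a * r)).
Proof. intros Ha Hr. field. split; nra. Qed.

(** * The extremal function *)

(** An automorphism of the disk for which both the growth estimate, at nonpositive
    real points, and the majorant estimate are equalities. *)
Definition blaschke (a : R) (z : C) : C := ((a - z) / (1 - a * z))%C.

Definition blaschke_coef (a : R) (n : nat) : C :=
  match n with O => RtoC a | S m => (- ((1 - a ^ 2) * a ^ m))%R end.

Lemma blaschke_denominator_neq_0 a z : 0 < a < 1 -> unit_disk z -> (1 - a * z)%C <> 0.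
Proof.
intros Ha Hz. unfold unit_disk in Hz. apply one_minus_neq_0.
rewrite Cmod_mult, Cmod_R, Rabs_pos_eq by lra. pose proof (Cmod_ge_0 z). nra.
Qed.

Lemma blaschke_in_disk a z : 0 < a < 1 -> unit_disk z -> unit_disk (blaschke a z).
Proof.
intros Ha Hz. pose proof (blaschke_denominator_neq_0 a z Ha Hz) as Hn.
unfold unit_disk, blaschke in *.
rewrite Cmod_div by exact Hn.
apply Cmod_gt_0 in Hn. apply Rcomplements.Rlt_div_l; [exact Hn|]. rewrite Rmult_1_l.
assert (E : Cmod (1 - a * z) ^ 2 - Cmod (a - z) ^ 2 = (1 - a ^ 2) * (1 - Cmod z ^ 2)).
{ rewrite !Cmod2_alt. destruct z as [x y]. simpl. ring. }
pose proof (Cmod_ge_0 z). pose proof (Cmod_ge_0 (a - z)).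
assert (0 < (1 - a ^ 2) * (1 - Cmod z ^ 2)) by (apply Rmult_lt_0_compat; nra).
nra.
Qed.

Definition blaschke_local_coef (a : R) (z0 : C) (n : nat) : C :=
  match n with
  | O => blaschke a z0
  | S m => (- ((1 - a ^ 2) * a ^ m) / (1 - a * z0) ^ (m + 2))%C
  end.

(** With [e = 1 - a * z0] and [q = a * (z - z0) / e] one has [1 - a * z = e * (1 - q)],
    so the function is a constant plus a multiple of the geometric series of
    ratio [q]. *)
Lemma blaschke_local_expansion a z0 z : 0 < a < 1 -> unit_disk z0 ->
  Cmod (a * (z - z0)) < Cmod (1 - a * z0) ->
  is_pseries (blaschke_local_coef a z0) (z - z0)%C (blaschke a z).
Proof.
intros Ha Hz0 Hz. pose proof (blaschke_denominator_neq_0 a z0 Ha Hz0) as Hn.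
set (e := (1 - a * z0)%C) in *.
set (q := (a * (z - z0) / e)%C).
assert (He : 0 < Cmod e) by (apply Cmod_gt_0, Hn).
assert (Hq : Cmod q < 1).
{ unfold q. rewrite Cmod_div by exact Hn. apply Rcomplements.Rlt_div_l; lra. }
pose proof (taylor_geom q Hq) as Hg.
pose proof (proj1 (is_pseries_partial_sum _ _ _) Hg) as Hg'. clear Hg.
apply is_pseries_partial_sum. intros eps Heps.
set (K := (- (1 - a ^ 2) * (z - z0) / e ^ 2)%C).
assert (E1 : (1 - q)%C <> 0) by (apply one_minus_neq_0, Hq).
assert (Efac : (e * (1 - q))%C = (1 - a * z)%C) by (unfold q, e; field; exact Hn).
assert (Haz : (1 - a * z)%C <> 0).
{ rewrite <- Efac. apply Cmult_neq_0; assumption. }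
assert (Eb : blaschke a z = (blaschke a z0 + K * / (1 - q))%C).
{ transitivity (blaschke a z0 + K * (e * / (e * (1 - q))))%C.
  - rewrite Efac. unfold K, blaschke. fold e. unfold e in *. field. auto.
  - f_equal. f_equal. field. auto. }
set (c := blaschke_local_coef a z0).
assert (EN : forall N, partial_sum c (S N) (z - z0) =
  (blaschke a z0 + K * partial_sum (fun _ => 1%C) N q)%C).
{ intros N. induction N as [|N IH].
  - rewrite partial_sum_S, !partial_sum_O. unfold c, blaschke_local_coef, K. fold e.
    simpl. field. exact Hn.
  - rewrite partial_sum_S, IH, (partial_sum_S _ N).
    enough (c (S (S N)) * (z - z0) ^ S (S N) = K * (1 * q ^ S N))%C as -> by ring.
    unfold c, blaschke_local_coef, K, q. fold e. rewrite Cpow_add_r. unfold Cdiv.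
    rewrite !Cpow_mult_l, Cpow_inv by exact Hn. rewrite !Cpow_S.
    field. auto using Cpow_nz. }
pose proof (Cmod_ge_0 K).
destruct (Hg' (eps / (Cmod K + 1))) as [N0 HN]; [apply Rdiv_lt_0_compat; lra|].
exists (S N0). intros [|N] HNN; [lia|]. specialize (HN N ltac:(lia)).
rewrite EN, Eb.
match goal with |- Cmod ?x < _ => replace x with
  (K * (partial_sum (fun _ => 1%C) N q - / (1 - q)))%C by ring end.
rewrite Cmod_mult.
apply Rle_lt_trans with (Cmod K * (eps / (Cmod K + 1))).
- apply Rmult_le_compat_l; lra.
- apply (Rmult_lt_reg_r (Cmod K + 1)); [lra|]. field_simplify; nra.
Qed.

Lemma blaschke_analytic a : 0 < a < 1 -> analytic_self_map (blaschke a).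
Proof.
intros Ha. split; [|intros z; apply blaschke_in_disk, Ha]. intros z0 Hz0.
exists (blaschke_local_coef a z0), (Cmod (1 - a * z0)). split.
- apply Cmod_gt_0, blaschke_denominator_neq_0; assumption.
- intros z Hz. apply blaschke_local_expansion; try assumption.
  rewrite Cmod_mult, Cmod_R, Rabs_pos_eq by lra.
  pose proof (Cmod_ge_0 (z - z0)). nra.
Qed.

Lemma blaschke_taylor a : 0 < a < 1 -> taylor_expansion (blaschke a) (blaschke_coef a).
Proof.
intros Ha z Hz. unfold unit_disk in Hz.
assert (H0 : unit_disk 0) by (unfold unit_disk; rewrite Cmod_0; lra).
pose proof (blaschke_local_expansion a 0 z Ha H0) as Hc.
assert (E0 : (1 - a * 0)%C = RtoC 1) by ring.
assert (Ez : (z - 0)%C = z) by ring.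
rewrite Ez, E0 in Hc.
assert (E : forall n, blaschke_local_coef a 0 n = blaschke_coef a n).
{ intros [|m]; unfold blaschke_local_coef; cbn [blaschke_coef].
  - unfold blaschke. rewrite E0. field.
  - rewrite E0, Cpow_1_l, RtoC_opp, !RtoC_mult, RtoC_minus, !RtoC_pow. field. }
apply (is_pseries_ext (blaschke_local_coef a 0)); [exact E|].
apply Hc. rewrite Cmod_1, Cmod_mult, Cmod_R, Rabs_pos_eq by lra.
pose proof (Cmod_ge_0 z). nra.
Qed.

Lemma blaschke_majorant a r : 0 < a < 1 -> 0 <= r < 1 ->
  majorant_series (blaschke_coef a) r = a + r * (1 - a ^ 2) / (1 - a * r).
Proof.
intros Ha Hr. unfold majorant_series. apply is_pseries_unique.
apply is_pseries_R.
assert (Hg : is_series (fun n => (a * r) ^ n) (/ (1 - a * r))).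
{ apply is_series_geom. rewrite Rabs_pos_eq; nra. }
apply (is_series_scal_l (r * (1 - a ^ 2))) in Hg.
apply (is_series_decr_1 (V := R_NormedModule)).
match goal with |- is_series ?s ?l =>
  replace l with (scal (r * (1 - a ^ 2)) (/ (1 - a * r))) end.
- apply is_series_ext with (2 := Hg). intros n. cbn [blaschke_coef].
  rewrite Cmod_R, Rabs_Ropp, Rabs_pos_eq.
  + change scal with Rmult. rewrite Rpow_mult_distr. simpl. ring.
  + apply Rmult_le_pos; [nra|]. apply pow_le. lra.
- cbn [blaschke_coef]. rewrite Cmod_R, Rabs_pos_eq by lra.
  change scal with Rmult. change plus with Rplus. change opp with Ropp. simpl. field. nra.
Qed.

Lemma Cmod_blaschke_neg a r : 0 < a < 1 -> 0 <= r < 1 ->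
  Cmod (blaschke a (- r)%R) = (a + r) / (1 + a * r).
Proof.
intros Ha Hr. unfold blaschke.
replace ((a - (- r)%R) / (1 - a * (- r)%R))%C with (RtoC ((a + r) / (1 + a * r))).
- rewrite Cmod_R, Rabs_pos_eq; [reflexivity|]. apply Rdiv_le_0_compat; nra.
- rewrite RtoC_div, !RtoC_plus, RtoC_mult, RtoC_opp by nra.
  unfold Cdiv. f_equal; [ring|]. f_equal. ring.
Qed.

(** * The sharp inequality *)

Lemma schur_sum_le_1 f A z : schur_function f A ->
  0 < Cmod (A 0%nat) -> 0 <= quartic (Cmod (A 0%nat)) ->
  Cmod z <= bohr_radius (Cmod (A 0%nat)) ->
  Cmod (f z) + majorant_series A (Cmod z) - Cmod (A 0%nat) <= 1.
Proof.
intros Hf Ha0 Hq Hz. pose proof (Cmod_coef_0_lt_1 f A Hf) as Ha1.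
pose proof (bohr_radius_le_self _ Ha0 Hq) as Hself. pose proof (Cmod_ge_0 z) as Hr0.
assert (Hd : unit_disk z) by (unfold unit_disk; lra).
pose proof (growth_bound f A z Hf Hd) as Hgrowth.
assert (Hmaj : majorant_series A (Cmod z) <= Cmod (A 0%nat)
  + Cmod z * (1 - Cmod (A 0%nat) ^ 2) / (1 - Cmod (A 0%nat) * Cmod z)).
{ apply PSeries_le_of_partial_sums; [intros n; apply Cmod_ge_0|exact Hr0|].
  intros N. apply majorant_partial_sum_bound with f; [exact Hf|exact Ha0|lra]. }
apply le_bohr_radius in Hz; [|exact Ha0|exact Hr0].
unfold unit_disk in Hd.
set (a := Cmod (A 0%nat)) in *. set (r := Cmod z) in *.
pose proof (extremal_sum a r ltac:(lra) ltac:(lra)) as E.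
assert (Hneg : (1 - a) * (a ^ 2 * r ^ 2 + 2 * (1 + a) * r - 1)
   / ((1 + a * r) * (1 - a * r)) <= 0).
{ apply Rcomplements.Rle_div_l; [apply Rmult_lt_0_compat; nra|nra]. }
assert (Cmod (f z) <= (a + r) / (1 + a * r)).
{ apply Rcomplements.Rle_div_r; [nra|exact Hgrowth]. }
lra.
Qed.

Theorem theorem5 :
  (exists! x : R, 0 < x < 1 /\ x ^ 4 + 2 * x ^ 2 + 2 * x - 1 = 0) /\
  forall ta : R, 0 < ta < 1 -> ta ^ 4 + 2 * ta ^ 2 + 2 * ta - 1 = 0 ->
    Rabs (ta - 361103 / 10 ^ 6) <= 5 / 10 ^ 7 /\
    (forall (f : C -> C) (A : nat -> C),
       analytic_self_map f -> taylor_expansion f A ->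
       ta <= Cmod (A 0%nat) ->
       forall z : C, Cmod z <= bohr_radius (Cmod (A 0%nat)) ->
         Cmod (f z) + majorant_series A (Cmod z) - Cmod (A 0%nat) <= 1) /\
    (forall a : R, ta <= a < 1 ->
       forall rho : R, bohr_radius a < rho ->
         ~ (forall (f : C -> C) (A : nat -> C),
              analytic_self_map f -> taylor_expansion f A ->
              Cmod (f (RtoC 0)) = a ->
              forall z : C, unit_disk z -> Cmod z <= rho ->
                Cmod (f z) + majorant_series A (Cmod z) - Cmod (f (RtoC 0)) <= 1)).
Proof.
split; [exact quartic_root_unique|]. intros ta Hta Hq0.
fold (quartic ta) in Hq0.
assert (Hq : forall a, ta <= a -> 0 <= quartic a).
{ intros a Ha. destruct (Req_dec ta a) as [<-|Hne]; [lra|].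
  pose proof (quartic_increasing ta a ltac:(lra)). lra. }
split; [apply quartic_root_approx; assumption|]. split.
- intros f A [_ Hmap] HA Ha z Hz.
  apply schur_sum_le_1; [split; assumption|lra|apply Hq, Ha|exact Hz].
- intros a Ha rho Hrho Hall.
  assert (Ha' : 0 < a < 1) by lra.
  pose proof (bohr_radius_le_self a ltac:(lra) (Hq a ltac:(lra))) as Hself.
  pose proof (bohr_radius_pos a ltac:(lra)) as Hpos.
  (* capped below 1, so that [- r] lies in the disk even for large [rho] *)
  set (r := (bohr_radius a + Rmin rho 1) / 2).
  assert (Hm : bohr_radius a < Rmin rho 1) by (apply Rmin_glb_lt; lra).
  pose proof (Rmin_l rho 1). pose proof (Rmin_r rho 1).
  assert (Hr : bohr_radius a < r < 1 /\ r <= rho) by (unfold r; lra).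
  assert (Hb0 : Cmod (blaschke a (RtoC 0)) = a).
  { replace (blaschke a (RtoC 0)) with (RtoC a) by (unfold blaschke; field).
    rewrite Cmod_R, Rabs_pos_eq; lra. }
  assert (Hmr : Cmod (RtoC (- r)) = r) by (rewrite Cmod_R, Rabs_Ropp, Rabs_pos_eq; lra).
  specialize (Hall _ _ (blaschke_analytic a Ha') (blaschke_taylor a Ha') Hb0 (RtoC (- r))).
  unfold unit_disk in Hall.
  rewrite Hb0, Hmr, Cmod_blaschke_neg, blaschke_majorant in Hall by lra.
  specialize (Hall ltac:(lra) ltac:(lra)).
  pose proof (extremal_sum a r Ha' ltac:(lra)) as E.
  assert (Hnot : ~ r <= bohr_radius a) by lra. apply Hnot.
  apply le_bohr_radius; [lra|lra|].
  assert (Hle : (1 - a) * (a ^ 2 * r ^ 2 + 2 * (1 + a) * r - 1)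
     / ((1 + a * r) * (1 - a * r)) <= 0) by lra.
  apply Rcomplements.Rle_div_l in Hle; [nra|apply Rmult_lt_0_compat; nra].
Qed.
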